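(* Let $\mathcal{L}$ be a many-sorted signature in which every relation symbol and every function symbol is strict. If $\Gamma\cup\{\varphi\}$ is a set of well-sorted $\mathcal{L}$-sentences not containing the equality sign, then $$\Gamma\vdash_{\mathrm{MSL}}\varphi\quad\text{if and only if}\quad\Gamma^*,J\vdash_{\mathrm{FOL}}\varphi^*.$$
   Context: A many-sorted signature $\mathcal{L}$ consists of countable sets of relation symbols and function symbols, each with an arity $n\ge 0$ (0-ary function symbols are constants); a nonempty countable set $\mathrm{Sort}$ of sorts; pairwise disjoint countably infinite sets $\mathrm{Var}_i$ of variables of sort $i$, written $x^i$; and a function $\mathrm{rank}$ assigning to each $n$-ary relation symbol $R$ a nonempty set $\mathrm{rank}(R)\subseteq\mathrm{Sort}^n$, and to each $n$-ary function symbol $f$ a nonempty partial function $\mathrm{rank}(f)\subseteq \mathrm{Sort}^n\times\mathrm{Sort}$. $R$ is strict if $\mathrm{rank}(R)$ is a singleton; $f$ is strict if the domain of $\mathrm{rank}(f)$ is a singleton. Well-sorted terms: variables of $\mathrm{Var}_i$ have sort $i$; $f(t_1,\dots,t_n)$ has sort $i$ if the $t_k$ have sorts $i_k$ and $(i_1,\dots,i_n,i)\in\mathrm{rank}(f)$. Well-sorted formulas: $\bot$; $t_1=t_2$ for terms of the same sort; $R(t_1,\dots,t_n)$ when the tuple of sorts lies in $\mathrm{rank}(R)$; closure under $\land,\lor,\to,\exists x^i,\forall x^i$. $\Gamma\vdash_{\mathrm{MSL}}\varphi$: derivability in classical natural deduction with sorted quantifier rules ($\forall E$, $\exists I$ instantiate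 a variable of sort $i$ only by well-sorted terms of sort $i$; usual eigenvariable conditions), all formulas in the derivation being well-sorted, plus universal closures of sorted equality axioms (reflexivity, symmetry, transitivity of $=$ at each sort, and congruence for $R$ at each tuple in $\mathrm{rank}(R)$ and for $f$ at each tuple in the domain of $\mathrm{rank}(f)$). $\vdash_{\mathrm{FOL}}$: classical unsorted natural deduction plus universal closures of the usual equality axioms (reflexivity, symmetry, transitivity, congruence for every relation and function symbol). Translation: the unsorted signature $\mathcal{L}^*$ has the relation and function symbols of $\mathcal{L}$ plus a fresh unary relation symbol $Q_i$ for each $i\in\mathrm{Sort}$. Define $\bot^*=\bot$, $(t_1=t_2)^*=(t_1=t_2)$, $R(\vec t)^*=R(\vec t)$, $(\varphi\star\psi)^*=\varphi^*\star\psi^*$ for $\star\in\{\land,\lor,\to\}$, $(\forall x^i\varphi)^*=\forall x(Q_ix\to\varphi^* )$, $(\exists x^i\varphi)^*=\exists x(Q_ix\land\varphi^* )$; $\Gamma^*=\{\gamma^*:\gamma\in\Gamma\}$. $J$ is the set of universal closures of $\exists x\,Q_ix$ for each $i\in\mathrm{Sort}$, and $Q_{i_1}x_1\land\dots\land Q_{i_n}x_n\to Q_if(x_1,\dots,x_n)$ for each function symbol $f$ and each $(i_1,\dots,i_n,i)\in\mathrm{rank}(f)$ (in particular $Q_ic$ for each constant $c$ of sort $i$). *)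

(* Defs.v *)
From HB Require Import structures.
From mathcomp Require Import all_boot classical_sets.

Set Implicit Arguments.
Unset Strict Implicit.
Unset Printing Implicit Defensive.

Local Open Scope classical_set_scope.

Record fsig := FSig { funsym : countType; farity : funsym -> nat }.

Record usig := USig {
  usig_fun :> fsig;
  relsym : countType;
  rarity : relsym -> nat }.

Inductive term (F : fsig) (V : eqType) : Type :=
| tVar (x : V)
| tApp (f : funsym F) (ts : 'I_(farity f) -> term F V).
Arguments tVar {F V} x.
Arguments tApp {F V} f ts.

Inductive formula (S : usig) (V : eqType) : Type :=
| fBot
| fEq (t u : term S V)
| fRel (R : relsym S) (ts : 'I_(rarity R) -> term S V)
| fAnd (phi psi : formula S V)
| fOr (phi psi : formula S V)
| fImp (phi psi : formula S V)
| fEx (x : V) (phi : formula S V)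
| fAll (x : V) (phi : formula S V).
Arguments fBot {S V}.
Arguments fEq {S V} t u.
Arguments fRel {S V} R ts.
Arguments fEx {S V} x phi.
Arguments fAll {S V} x phi.

Definition fNot (S : usig) (V : eqType) (phi : formula S V) := fImp phi fBot.

Section Syntax.
Variables (S : usig) (V : eqType).
Implicit Types (x y z : V) (t u : term S V) (phi psi : formula S V).

Fixpoint occurs x t : bool :=
  match t with
  | tVar y => x == y
  | tApp f ts => [exists k, occurs x (ts k)]
  end.

Fixpoint free x phi : bool :=
  match phi with
  | fBot => false
  | fEq t u => occurs x t || occurs x u
  | fRel R ts => [exists k, occurs x (ts k)]
  | fAnd phi psi | fOr phi psi | fImp phi psi => free x phi || free x psi
  | fEx y phi | fAll y phi => (x != y) && free x phi
  end.

Definition sentence phi := forall x, ~~ free x phi.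

Fixpoint eq_free phi : bool :=
  match phi with
  | fEq _ _ => false
  | fBot | fRel _ _ => true
  | fAnd phi psi | fOr phi psi | fImp phi psi => eq_free phi && eq_free psi
  | fEx _ phi | fAll _ phi => eq_free phi
  end.

Fixpoint tsubst t x u : term S V :=
  match u with
  | tVar y => if x == y then t else tVar y
  | tApp f us => tApp f (fun k => tsubst t x (us k))
  end.

(* [subst t x phi] does not rename bound variables; it is the usual phi[t/x]
   only under [free_for t x phi], which the deduction rules require. *)
Fixpoint subst t x phi : formula S V :=
  match phi with
  | fBot => fBot
  | fEq u v => fEq (tsubst t x u) (tsubst t x v)
  | fRel R us => fRel R (fun k => tsubst t x (us k))
  | fAnd phi psi => fAnd (subst t x phi) (subst t x psi)
  | fOr phi psi => fOr (subst t x phi) (subst t x psi)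
  | fImp phi psi => fImp (subst t x phi) (subst t x psi)
  | fEx y phi => fEx y (if x == y then phi else subst t x phi)
  | fAll y phi => fAll y (if x == y then phi else subst t x phi)
  end.

Fixpoint free_for t x phi : bool :=
  match phi with
  | fBot | fEq _ _ | fRel _ _ => true
  | fAnd phi psi | fOr phi psi | fImp phi psi =>
      free_for t x phi && free_for t x psi
  | fEx y psi | fAll y psi =>
      ~~ free x phi || (~~ occurs y t && free_for t x psi)
  end.

(* The free variables may be quantified in any order. *)
Definition closures phi : set (formula S V) :=
  [set chi | exists xs : seq V,
     [/\ uniq xs, forall x, (x \in xs) = free x phi
       & chi = foldr fAll phi xs]].

(* phi_1 /\ ... /\ phi_n -> psi, read as psi itself when n = 0. *)
Definition conj_imp (s : seq (formula S V)) psi : formula S V :=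
  if s is phi :: s' then fImp (foldl (@fAnd S V) phi s') psi else psi.

Definition ax_refl t := fEq t t.
Definition ax_sym t u := fImp (fEq t u) (fEq u t).
Definition ax_trans t u v := fImp (fAnd (fEq t u) (fEq u v)) (fEq t v).
Definition ax_cong_rel (R : relsym S) (ts us : 'I_(rarity R) -> term S V) :=
  conj_imp [seq fEq (ts k) (us k) | k : 'I_(rarity R)]
           (fImp (fRel R ts) (fRel R us)).
Definition ax_cong_fun (f : funsym S) (ts us : 'I_(farity f) -> term S V) :=
  conj_imp [seq fEq (ts k) (us k) | k : 'I_(farity f)]
           (fEq (tApp f ts) (tApp f us)).

(* Classical natural deduction, in which every formula must satisfy [wf] and
   a quantified variable x may only be instantiated by terms t with
   [inst x t]. [nd Gamma phi] means that phi has a derivation whose open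
   assumptions all belong to Gamma. The eigenvariable conditions constrain all
   of Gamma rather than the assumptions in use; [nd_weak] makes up for this by
   allowing Gamma to be cut down to the latter. Negation is implication of
   fBot. *)
Section NaturalDeduction.
Variables (wf : formula S V -> Prop) (inst : V -> term S V -> Prop).

Inductive nd : set (formula S V) -> formula S V -> Prop :=
| nd_ass Gamma phi : wf phi -> Gamma phi -> nd Gamma phi
| nd_weak Gamma Delta phi : Delta `<=` Gamma -> nd Delta phi -> nd Gamma phi
| nd_andI Gamma phi psi : wf (fAnd phi psi) ->
    nd Gamma phi -> nd Gamma psi -> nd Gamma (fAnd phi psi)
| nd_andEl Gamma phi psi : wf phi -> nd Gamma (fAnd phi psi) -> nd Gamma phi
| nd_andEr Gamma phi psi : wf psi -> nd Gamma (fAnd phi psi) -> nd Gamma psi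
| nd_orIl Gamma phi psi : wf (fOr phi psi) ->
    nd Gamma phi -> nd Gamma (fOr phi psi)
| nd_orIr Gamma phi psi : wf (fOr phi psi) ->
    nd Gamma psi -> nd Gamma (fOr phi psi)
| nd_orE Gamma phi psi chi : wf chi ->
    nd Gamma (fOr phi psi) ->
    nd (phi |` Gamma) chi -> nd (psi |` Gamma) chi -> nd Gamma chi
| nd_impI Gamma phi psi : wf (fImp phi psi) ->
    nd (phi |` Gamma) psi -> nd Gamma (fImp phi psi)
| nd_impE Gamma phi psi : wf psi ->
    nd Gamma (fImp phi psi) -> nd Gamma phi -> nd Gamma psi
| nd_botE Gamma phi : wf phi -> nd Gamma fBot -> nd Gamma phi
| nd_raa Gamma phi : wf phi -> nd (fNot phi |` Gamma) fBot -> nd Gamma phi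
| nd_allI Gamma x y phi : wf (fAll x phi) ->
    inst x (tVar y) -> free_for (tVar y) x phi ->
    (forall psi, Gamma psi -> ~~ free y psi) -> ~~ free y (fAll x phi) ->
    nd Gamma (subst (tVar y) x phi) -> nd Gamma (fAll x phi)
| nd_allE Gamma x t phi : wf (subst t x phi) ->
    inst x t -> free_for t x phi ->
    nd Gamma (fAll x phi) -> nd Gamma (subst t x phi)
| nd_exI Gamma x t phi : wf (fEx x phi) ->
    inst x t -> free_for t x phi ->
    nd Gamma (subst t x phi) -> nd Gamma (fEx x phi)
| nd_exE Gamma x y phi chi : wf chi ->
    inst x (tVar y) -> free_for (tVar y) x phi ->
    (forall psi, Gamma psi -> ~~ free y psi) ->
    ~~ free y (fEx x phi) -> ~~ free y chi ->
    nd Gamma (fEx x phi) -> nd (subst (tVar y) x phi |` Gamma) chi ->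
    nd Gamma chi.

End NaturalDeduction.

(* Here and below the variables of an axiom scheme need not be distinct: the
   instances with repetitions follow from the others. *)
Inductive fol_eq_matrix : formula S V -> Prop :=
| fol_refl x : fol_eq_matrix (ax_refl (tVar x))
| fol_sym x y : fol_eq_matrix (ax_sym (tVar x) (tVar y))
| fol_trans x y z : fol_eq_matrix (ax_trans (tVar x) (tVar y) (tVar z))
| fol_cong_rel (R : relsym S) (xs ys : 'I_(rarity R) -> V) :
    fol_eq_matrix (@ax_cong_rel R (fun k => tVar (xs k)) (fun k => tVar (ys k)))
| fol_cong_fun (f : funsym S) (xs ys : 'I_(farity f) -> V) :
    fol_eq_matrix (@ax_cong_fun f (fun k => tVar (xs k)) (fun k => tVar (ys k))).

Definition fol_eq_axioms : set (formula S V) :=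
  [set chi | exists2 phi, fol_eq_matrix phi & closures phi chi].

Definition fol_provable (Gamma : set (formula S V)) phi : Prop :=
  nd (fun=> True) (fun _ _ => True) (Gamma `|` fol_eq_axioms) phi.

End Syntax.

Record msig := MSig {
  msig_usig :> usig;
  msort : countType;
  msort_inhabited : inhabited msort;
  rrank : forall R : relsym msig_usig, ('I_(rarity R) -> msort) -> Prop;
  rrank_nonempty : forall R : relsym msig_usig, exists js, @rrank R js;
  frank : forall f : funsym msig_usig,
    ('I_(farity f) -> msort) -> msort -> Prop;
  frank_nonempty : forall f : funsym msig_usig, exists js i, @frank f js i;
  frank_functional : forall (f : funsym msig_usig) js i i',
    @frank f js i -> @frank f js i' -> i = i' }.
Arguments rrank {m} R js.
Arguments frank {m} f js i.

Definition strict_rel (L : msig) (R : relsym L) : Prop :=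
  exists! js, rrank R js.

Definition strict_fun (L : msig) (f : funsym L) : Prop :=
  exists! js, exists i, frank f js i.

(* Var_i is the set of pairs (i, n) with n a natural number. *)
Definition mvar (L : msig) : eqType := (msort L * nat)%type.

Definition svar (L : msig) (i : msort L) (n : nat) : term L (mvar L) :=
  tVar ((i, n) : mvar L).

Inductive has_sort (L : msig) : term L (mvar L) -> msort L -> Prop :=
| has_sort_var (x : mvar L) : has_sort (tVar x) x.1
| has_sort_app (f : funsym L) ts js i : frank f js i ->
    (forall k, has_sort (ts k) (js k)) -> has_sort (tApp f ts) i.

Fixpoint well_sorted (L : msig) (phi : formula L (mvar L)) : Prop :=
  match phi with
  | fBot => True
  | fEq t u => exists i, has_sort t i /\ has_sort u i
  | fRel R ts => exists2 js, rrank R js & forall k, has_sort (ts k) (js k)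
  | fAnd phi psi | fOr phi psi | fImp phi psi =>
      well_sorted phi /\ well_sorted psi
  | fEx _ phi | fAll _ phi => well_sorted phi
  end.

Inductive msl_eq_matrix (L : msig) : formula L (mvar L) -> Prop :=
| msl_refl (i : msort L) m : msl_eq_matrix (ax_refl (svar i m))
| msl_sym (i : msort L) m n : msl_eq_matrix (ax_sym (svar i m) (svar i n))
| msl_trans (i : msort L) m n p :
    msl_eq_matrix (ax_trans (svar i m) (svar i n) (svar i p))
| msl_cong_rel (R : relsym L) js (ms ns : 'I_(rarity R) -> nat) :
    rrank R js ->
    msl_eq_matrix (@ax_cong_rel L (mvar L) R
      (fun k => svar (js k) (ms k)) (fun k => svar (js k) (ns k)))
| msl_cong_fun (f : funsym L) js i (ms ns : 'I_(farity f) -> nat) :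
    frank f js i ->
    msl_eq_matrix (@ax_cong_fun L (mvar L) f
      (fun k => svar (js k) (ms k)) (fun k => svar (js k) (ns k))).

Definition msl_eq_axioms (L : msig) : set (formula L (mvar L)) :=
  [set chi | exists2 phi, msl_eq_matrix phi & closures phi chi].

Definition msl_provable (L : msig) (Gamma : set (formula L (mvar L)))
    (phi : formula L (mvar L)) : Prop :=
  nd (@well_sorted L) (fun x t => has_sort t x.1)
     (Gamma `|` @msl_eq_axioms L) phi.

(* The relation symbol [inr i] is Q_i. The unsorted variables of the starred
   signature are those of all the sets Var_i together, so that the translation
   leaves variables and terms unchanged. *)
Definition star_sig (L : msig) : usig :=
  @USig L (relsym L + msort L)%type
    (fun R => match R with inl R => rarity R | inr _ => 1 end).

Definition fQ (L : msig) (i : msort L) (t : term L (mvar L)) :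
    formula (star_sig L) (mvar L) :=
  @fRel (star_sig L) (mvar L) (inr i) (fun=> t).

Fixpoint star (L : msig) (phi : formula L (mvar L)) :
    formula (star_sig L) (mvar L) :=
  match phi with
  | fBot => fBot
  | fEq t u => @fEq (star_sig L) (mvar L) t u
  | fRel R ts => @fRel (star_sig L) (mvar L) (inl R) ts
  | fAnd phi psi => fAnd (star phi) (star psi)
  | fOr phi psi => fOr (star phi) (star psi)
  | fImp phi psi => fImp (star phi) (star psi)
  | fEx x phi => fEx x (fAnd (fQ x.1 (tVar x)) (star phi))
  | fAll x phi => fAll x (fImp (fQ x.1 (tVar x)) (star phi))
  end.

Inductive J_matrix (L : msig) : formula (star_sig L) (mvar L) -> Prop :=
| J_nonempty (i : msort L) (x : mvar L) : J_matrix (fEx x (fQ i (tVar x)))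
| J_fun (f : funsym L) js i (xs : 'I_(farity f) -> mvar L) : frank f js i ->
    J_matrix (conj_imp [seq fQ (js k) (tVar (xs k)) | k : 'I_(farity f)]
                       (fQ i (tApp f (fun k => tVar (xs k))))).

Definition J (L : msig) : set (formula (star_sig L) (mvar L)) :=
  [set chi | exists2 phi, J_matrix phi & closures phi chi].

(* Main.v *)
(* From left to right, an MSL derivation is relativized rule by rule: its
   translation is derivable in FOL under finitely many extra assumptions Q_i x
   on variables of sort i, which are discharged at the end since J makes every
   Q_i inhabited.

   From right to left, FOL is sound for a classical forcing semantics in which
   the regular elements are those equal to their double negation relative to a
   pole, and it is interpreted in a syntactic model: worlds are finite sets of
   MSL assumptions added to Gamma, the pole collects the inconsistent ones, the
   universe consists of all terms, well-sorted or not, Q_i is "has sort i", and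
   equality is identity of terms. The star of an equality-free formula is then
   forced exactly where the formula is MSL-derivable, so no maximal consistent
   extension is needed. As substitution does not rename bound variables, Gamma
   is first cut down to the formulas whose variables have index below some N,
   and Q_i is restricted to terms with variables of index at least N. *)

Require Import Defs.
From Stdlib Require List.
From mathcomp Require Import all_boot boolp classical_sets.

Set Implicit Arguments.
Unset Strict Implicit.
Unset Printing Implicit Defensive.

Local Open Scope classical_set_scope.

(** * Substitution *)

Section Valuations.
Variables (V : eqType) (D : Type).
Implicit Types (v : V -> D) (x y : V) (d : D).

Definition upd v x d : V -> D := fun y => if x == y then d else v y.

Lemma upd_eq v x d : upd v x d x = d.
Proof. by rewrite /upd eqxx. Qed.

Lemma upd_upd v x d d' : upd (upd v x d) x d' = upd v x d'.
Proof. by apply: funext => y; rewrite /upd; case: eqP. Qed.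

Lemma updC v x y d e : x != y -> upd (upd v x d) y e = upd (upd v y e) x d.
Proof.
move=> nxy; apply: funext => z; rewrite /upd.
case: eqP => [<-|//]; by rewrite (negPf nxy).
Qed.

Variables (F : fsig) (app : forall f : funsym F, ('I_(farity f) -> D) -> D).

(** The domain [D] is left open: terms over themselves with [tApp] give simultaneous substitution,
    while the forcing semantics evaluates terms in its universe. *)
Fixpoint eval v (t : term F V) : D :=
  match t with
  | tVar x => v x
  | tApp f ts => app (fun k => eval v (ts k))
  end.
End Valuations.

Section Substitution.
Variables (S : usig) (V : eqType).
Implicit Types (x y z : V) (t u : term S V) (phi psi : formula S V).

Lemma eval_ext (D : Type) app (v w : V -> D) t :
  (forall x, @occurs S V x t -> v x = w x) -> eval app v t = eval app w t.
Proof.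
elim: t => [x|f ts IH] /= vw; first by apply: vw; rewrite /= eqxx.
congr app; apply: funext => k; apply: IH => x xk.
by apply: vw; apply/existsP; exists k.
Qed.

Definition tmsubst (v : V -> term S V) t := eval (@tApp S V) v t.

Lemma tmsubst_tVar t : tmsubst tVar t = t.
Proof. by elim: t => //= f ts IH; congr tApp; apply: funext. Qed.

Lemma tsubstE t x u : tsubst t x u = tmsubst (upd tVar x t) u.
Proof. by elim: u => //= f us IH; congr tApp; apply: funext. Qed.

Lemma tsubst_tmsubst t x v u :
  tsubst t x (tmsubst v u) = tmsubst (fun y => tsubst t x (v y)) u.
Proof. by elim: u => //= f us IH; congr tApp; apply: funext. Qed.

Lemma tsubst_notin t x u : ~~ occurs x u -> tsubst t x u = u.
Proof.
move=> nxu; rewrite tsubstE -[RHS]tmsubst_tVar; apply: eval_ext => y yu.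
by rewrite /upd; case: eqP => // xy; rewrite xy yu in nxu.
Qed.

Lemma eval_tsubst (D : Type) app (v : V -> D) t x u :
  eval app v (@tsubst S V t x u) = eval app (upd v x (eval app v t)) u.
Proof.
elim: u => [y|f us IH] /=; first by rewrite /upd; case: eqP.
by congr app; apply: funext.
Qed.

(** Like [subst], this does not rename bound variables, so capture has to be excluded where it is
    used. It turns a valuation in a universe of terms into an operation on formulas. *)
Fixpoint msubst (v : V -> term S V) phi : formula S V :=
  match phi with
  | fBot => fBot
  | fEq t u => fEq (tmsubst v t) (tmsubst v u)
  | fRel R ts => fRel R (fun k => tmsubst v (ts k))
  | fAnd phi psi => fAnd (msubst v phi) (msubst v psi)
  | fOr phi psi => fOr (msubst v phi) (msubst v psi)
  | fImp phi psi => fImp (msubst v phi) (msubst v psi)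
  | fEx x phi => fEx x (msubst (upd v x (tVar x)) phi)
  | fAll x phi => fAll x (msubst (upd v x (tVar x)) phi)
  end.

Lemma msubst_ext v w phi :
  (forall x, free x phi -> v x = w x) -> msubst v phi = msubst w phi.
Proof.
elim: phi v w => //=.
- move=> t u v w vw; congr fEq; apply: eval_ext => x xt; apply: vw;
    by rewrite xt ?orbT.
- move=> R ts v w vw; congr fRel; apply: funext => k; apply: eval_ext => x xk.
  by apply: vw; apply/existsP; exists k.
- by move=> ? IH1 ? IH2 v w vw; congr fAnd; [apply: IH1|apply: IH2] => x xp;
    apply: vw; rewrite xp ?orbT.
- by move=> ? IH1 ? IH2 v w vw; congr fOr; [apply: IH1|apply: IH2] => x xp;
    apply: vw; rewrite xp ?orbT.
- by move=> ? IH1 ? IH2 v w vw; congr fImp; [apply: IH1|apply: IH2] => x xp;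
    apply: vw; rewrite xp ?orbT.
- move=> y phi IH v w vw; congr fEx; apply: IH => x xp.
  rewrite /upd; case: eqP => // /eqP yx; apply: vw.
  by rewrite eq_sym yx.
- move=> y phi IH v w vw; congr fAll; apply: IH => x xp.
  rewrite /upd; case: eqP => // /eqP yx; apply: vw.
  by rewrite eq_sym yx.
Qed.

Lemma upd_tVar x : upd (@tVar S V) x (tVar x) = tVar.
Proof. by apply: funext => y; rewrite /upd; case: eqP => [->|]. Qed.

Lemma msubst_tVar phi : msubst tVar phi = phi.
Proof.
elim: phi => //=; rewrite ?tmsubst_tVar //.
- by move=> t u; rewrite !tmsubst_tVar.
- by move=> R ts; congr fRel; apply: funext => k; rewrite tmsubst_tVar.
- by move=> ? -> ? ->.
- by move=> ? -> ? ->.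
- by move=> ? -> ? ->.
- by move=> x phi IH; rewrite upd_tVar IH.
- by move=> x phi IH; rewrite upd_tVar IH.
Qed.

Lemma msubst_sentence v phi : sentence phi -> msubst v phi = phi.
Proof.
move=> sphi; rewrite -[RHS]msubst_tVar; apply: msubst_ext => x.
by rewrite (negPf (sphi x)).
Qed.

(* The hypothesis on [v] is what makes the naive [msubst] safe here. *)
Lemma subst_msubst t x v phi : (forall z, z != x -> ~~ occurs x (v z)) ->
  subst t x (msubst (upd v x (tVar x)) phi) = msubst (upd v x t) phi.
Proof.
have tE w u : (forall z, z != x -> ~~ occurs x (w z)) ->
    tsubst t x (tmsubst (upd w x (tVar x)) u) = tmsubst (upd w x t) u.
  move=> nw; rewrite tsubst_tmsubst; congr (tmsubst _ u); apply: funext => z.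
  rewrite /upd; case: (eqVneq x z) => [_|xz] /=; first by rewrite eqxx.
  by rewrite tsubst_notin // nw // eq_sym.
(* The hypothesis on [v] survives passage under a binder other than [x]. *)
have nupd w y : x != y -> (forall z, z != x -> ~~ occurs x (w z)) ->
    forall z, z != x -> ~~ occurs x (upd w y (tVar y) z).
  by move=> xy nw z zx; rewrite /upd; case: eqP => // _; apply: nw.
elim: phi v => //=.
- by move=> u u' v nv; rewrite !tE.
- by move=> R ts v nv; congr fRel; apply: funext => k; rewrite tE.
- by move=> ? IH1 ? IH2 v nv; rewrite IH1 // IH2.
- by move=> ? IH1 ? IH2 v nv; rewrite IH1 // IH2.
- by move=> ? IH1 ? IH2 v nv; rewrite IH1 // IH2.
- move=> y phi IH v nv; congr fEx; case: eqP => [<-|/eqP xy].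
    by rewrite !upd_upd.
  by rewrite (updC _ _ _ xy) IH ?(updC _ _ _ xy) //; apply: nupd.
- move=> y phi IH v nv; congr fAll; case: eqP => [<-|/eqP xy].
    by rewrite !upd_upd.
  by rewrite (updC _ _ _ xy) IH ?(updC _ _ _ xy) //; apply: nupd.
Qed.

Lemma substE t x phi : subst t x phi = msubst (upd tVar x t) phi.
Proof.
rewrite -(@subst_msubst t x tVar) ?upd_tVar ?msubst_tVar // => z.
by rewrite eq_sym.
Qed.

Lemma subst_notfree t x phi : ~~ free x phi -> subst t x phi = phi.
Proof.
move=> nx; rewrite substE -[RHS]msubst_tVar; apply: msubst_ext => y yp.
by rewrite /upd; case: eqP => // xy; rewrite xy yp in nx.
Qed.

Lemma subst_id x phi : subst (tVar x) x phi = phi.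
Proof. by rewrite substE upd_tVar msubst_tVar. Qed.

Lemma free_for_id x phi : free_for (tVar x) x phi.
Proof.
elim: phi => //= [? -> ? -> //|? -> ? -> //|? -> ? -> //|y phi ->|y phi ->];
  by rewrite andbT (eq_sym y); case: (x == y); rewrite /= ?orbT.
Qed.

End Substitution.

(** * Universal closures and iterated implications *)

Section Closures.
Variables (S : usig) (V : eqType).
Implicit Types (x y : V) (phi psi : formula S V).

Lemma free_foldr_fAll y xs phi :
  free y (foldr (@fAll S V) phi xs) = (y \notin xs) && free y phi.
Proof. by elim: xs => //= x xs ->; rewrite inE negb_or andbA. Qed.

Lemma closures_sentence phi chi : closures phi chi -> sentence chi.
Proof.
by move=> [xs [_ fxs ->]] y; rewrite free_foldr_fAll fxs andNb.
Qed.

Lemma free_conj_imp (I : eqType) (G : I -> formula S V) s psi x :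
  free x (conj_imp (map G s) psi) = has (fun k => free x (G k)) s || free x psi.
Proof.
case: s => //= a s; congr (_ || _).
elim: s (G a) => [|b s IH] chi /=; first by rewrite orbF.
by rewrite IH /= orbA.
Qed.

End Closures.

(** * Derivability *)

Section Deduction.
Variables (S : usig) (V : eqType).
Variables (wf : formula S V -> Prop) (inst : V -> term S V -> Prop).
Implicit Types (Gamma : set (formula S V)) (phi psi : formula S V).

Lemma nd_wf Gamma phi : nd wf inst Gamma phi -> wf phi.
Proof. by elim. Qed.

(* Derivations are finite, so bounding any measure [m] of the assumptions by a
   large enough number loses nothing. *)
Lemma nd_bounded (m : formula S V -> nat) Gamma phi : nd wf inst Gamma phi ->
  exists N, forall M, N <= M ->
    nd wf inst (Gamma `&` [set psi | m psi <= M]) phi.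
Proof.
have sub A G M : (A |` G) `&` [set psi | m psi <= M] `<=`
    A |` (G `&` [set psi | m psi <= M]).
  by move=> chi [[->|Gc] mc]; [left|right].
have fr (y : V) G M : (forall psi, G psi -> ~~ free y psi) ->
    forall psi, (G `&` [set psi | m psi <= M]) psi -> ~~ free y psi.
  by move=> nG psi [/nG].
elim=> {Gamma phi}.
- by move=> G phi wp Gp; exists (m phi) => M le; apply: nd_ass.
- move=> G D phi sD _ [N IH]; exists N => M /IH; apply: nd_weak.
  by move=> psi [/sD].
- move=> G phi psi w _ [N1 IH1] _ [N2 IH2]; exists (maxn N1 N2) => M.
  by rewrite geq_max => /andP[/IH1 ? /IH2 ?]; apply: nd_andI.
- by move=> G phi psi w _ [N IH]; exists N => M /IH; apply: nd_andEl.
- by move=> G phi psi w _ [N IH]; exists N => M /IH; apply: nd_andEr.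
- by move=> G phi psi w _ [N IH]; exists N => M /IH; apply: nd_orIl.
- by move=> G phi psi w _ [N IH]; exists N => M /IH; apply: nd_orIr.
- move=> G phi psi chi w _ [N1 IH1] _ [N2 IH2] _ [N3 IH3].
  exists (maxn N1 (maxn N2 N3)) => M.
  rewrite !geq_max => /and3P[/IH1 h1 /IH2 h2 /IH3 h3].
  by apply: nd_orE w h1 _ _; [apply: nd_weak h2|apply: nd_weak h3].
- move=> G phi psi w _ [N IH]; exists N => M /IH h.
  by apply: nd_impI w _; apply: nd_weak h.
- move=> G phi psi w _ [N1 IH1] _ [N2 IH2]; exists (maxn N1 N2) => M.
  by rewrite geq_max => /andP[/IH1 h1 /IH2]; apply: nd_impE w h1.
- by move=> G phi w _ [N IH]; exists N => M /IH; apply: nd_botE.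
- move=> G phi w _ [N IH]; exists N => M /IH h.
  by apply: nd_raa w _; apply: nd_weak h.
- move=> G x y phi w i ff nG nf _ [N IH]; exists N => M /IH.
  by apply: nd_allI => //; apply: fr.
- by move=> G x t phi w i ff _ [N IH]; exists N => M /IH; apply: nd_allE.
- by move=> G x t phi w i ff _ [N IH]; exists N => M /IH; apply: nd_exI.
- move=> G x y phi chi w i ff nG nf nc _ [N1 IH1] _ [N2 IH2].
  exists (maxn N1 N2) => M; rewrite geq_max => /andP[/IH1 h1 /IH2 h2].
  by apply: (nd_exE w i ff _ nf nc h1); [apply: fr|apply: nd_weak h2].
Qed.

Lemma nd_conj_impE (I : eqType) (G : I -> formula S V) s psi Gamma :
  (forall phi, wf phi) ->
  nd wf inst Gamma (conj_imp (map G s) psi) ->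
  (forall k, k \in s -> nd wf inst Gamma (G k)) -> nd wf inst Gamma psi.
Proof.
move=> wfT; case: s => //= a s H Gs; apply: nd_impE H _ => //.
have: nd wf inst Gamma (G a) by apply: Gs; rewrite inE eqxx.
have {}Gs: forall k, k \in s -> nd wf inst Gamma (G k).
  by move=> k ks; apply: Gs; rewrite inE ks orbT.
(* The conjunction is a left fold, so the induction generalizes over the part accumulated so far. *)
elim: s (G a) Gs => //= b s IH chi Gs Hc; apply: IH.
  by move=> k ks; apply: Gs; rewrite inE ks orbT.
by apply: nd_andI => //; apply: Gs; rewrite inE eqxx.
Qed.

End Deduction.

(** * Forcing *)

Section Forcing.
Variables (S : usig) (V : eqType) (D : Type).
Variable app : forall f : funsym S, ('I_(farity f) -> D) -> D.
Variables (W : Type) (le : W -> W -> Prop) (pole : W -> Prop).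
Variable rel : forall R : relsym S, ('I_(rarity R) -> D) -> W -> Prop.
Hypothesis le_refl : forall w, le w w.
Hypothesis le_trans : forall w1 w2 w3, le w1 w2 -> le w2 w3 -> le w1 w3.
Hypothesis pole_mono : forall w w', le w w' -> pole w -> pole w'.

(* The pole is the value of falsity, so this is the double negation of [A]. *)
Definition dneg (A : W -> Prop) (w : W) : Prop :=
  forall w', le w w' -> (forall w'', le w' w'' -> A w'' -> pole w'') -> pole w'.

Hypothesis rel_mono : forall R ts w w', le w w' -> @rel R ts w -> @rel R ts w'.
Hypothesis rel_stable : forall R ts w, dneg (@rel R ts) w -> @rel R ts w.

Implicit Types (v : V -> D) (w : W) (phi psi : formula S V).

(** All worlds share one universe, so [fAll] need not look at later worlds. The [dneg] at [fOr] and
    [fEx], and the pole added to equality, keep every value regular. *)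
Fixpoint force v phi (w : W) : Prop :=
  match phi with
  | fBot => pole w
  | fEq t u => eval app v t = eval app v u \/ pole w
  | fRel R ts => rel (fun k => eval app v (ts k)) w
  | fAnd phi psi => force v phi w /\ force v psi w
  | fOr phi psi => dneg (fun w' => force v phi w' \/ force v psi w') w
  | fImp phi psi => forall w', le w w' -> force v phi w' -> force v psi w'
  | fEx x phi => dneg (fun w' => exists d, force (upd v x d) phi w') w
  | fAll x phi => forall d, force (upd v x d) phi w
  end.

Lemma dneg_mono A w w' : le w w' -> dneg A w -> dneg A w'.
Proof. by move=> l h w1 l1; apply: h; apply: le_trans l1. Qed.

Lemma dneg_dneg A w : dneg (dneg A) w -> dneg A w.
Proof.
move=> h w' l k; apply: h l _ => w1 l1 h1; apply: h1 (le_refl _) _ => w2 l2.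
by apply: k; apply: le_trans l2.
Qed.

Lemma dneg_sub (A B : W -> Prop) w :
  (forall w', le w w' -> A w' -> B w') -> dneg A w -> dneg B w.
Proof.
move=> AB h w' l k; apply: (h w' l) => w1 l1 a; apply: k => //.
by apply: AB a; apply: le_trans l1.
Qed.

Lemma force_mono v phi w w' : le w w' -> force v phi w -> force v phi w'.
Proof.
elim: phi v w w' => /=.
- by move=> v w w'; apply: pole_mono.
- by move=> t u v w w' l [->|/(pole_mono l)]; [left|right].
- by move=> R ts v w w'; apply: rel_mono.
- by move=> ? IH1 ? IH2 v w w' l [/(IH1 _ _ _ l) ? /(IH2 _ _ _ l)].
- by move=> ? IH1 ? IH2 v w w' l; apply: dneg_mono.
- by move=> ? IH1 ? IH2 v w w' l h w1 l1; apply: h; apply: le_trans l1.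
- by move=> x phi IH v w w' l; apply: dneg_mono.
- by move=> x phi IH v w w' l h d; apply: IH l _.
Qed.

(** Regularity validates reductio ad absurdum. It also lets a proof of forcing assume an actual
    disjunct or witness where only the [dneg] of one is given. *)
Lemma force_stable v phi w : dneg (force v phi) w -> force v phi w.
Proof.
elim: phi v w => /=.
- by move=> v w; apply=> // w'.
- move=> t u v w h.
  (* Identity of values does not depend on the world, so it is decided classically; if it fails,
     only the pole can force the equation. *)
  case: (pselect (eval app v t = eval app v u)); first by left.
  by move=> tu; right; apply: h => // w' _ [].
- by move=> R ts v w; apply: rel_stable.
- move=> phi IH1 psi IH2 v w h; split; [apply: IH1|apply: IH2];
    by apply: dneg_sub h => w' _ [].
- by move=> phi _ psi _ v w; apply: dneg_dneg.
- move=> phi _ psi IH v w h w' l p; apply: IH.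
  apply: dneg_sub (dneg_mono l h) => w1 l1; apply => //.
  exact: force_mono p.
- by move=> x phi _ v w; apply: dneg_dneg.
- by move=> x phi IH v w h d; apply: IH; apply: dneg_sub h => w' _.
Qed.

Lemma force_pole v phi w : pole w -> force v phi w.
Proof. by move=> p; apply: force_stable => w' l _; apply: pole_mono l p. Qed.

Lemma force_ext v v' phi : (forall x, free x phi -> v x = v' x) ->
  force v phi = force v' phi.
Proof.
elim: phi v v' => //=.
- move=> t u v v' vv; apply: funext => w.
  by congr (_ = _ \/ _); apply: eval_ext => x xt; apply: vv; rewrite xt ?orbT.
- move=> R ts v v' vv; congr rel; apply: funext => k; apply: eval_ext => x xk.
  by apply: vv; apply/existsP; exists k.
- move=> phi IH1 psi IH2 v v' vv.
  rewrite (IH1 v v') ?(IH2 v v') // => x xp; apply: vv;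
  by rewrite xp ?orbT.
- move=> phi IH1 psi IH2 v v' vv.
  rewrite (IH1 v v') ?(IH2 v v') // => x xp; apply: vv;
  by rewrite xp ?orbT.
- move=> phi IH1 psi IH2 v v' vv.
  rewrite (IH1 v v') ?(IH2 v v') // => x xp; apply: vv;
  by rewrite xp ?orbT.
- move=> x phi IH v v' vv; congr dneg; apply: funext => w.
  apply: eq_exists => d; congr (_ w); apply: IH => y yp.
  by rewrite /upd; case: eqVneq => // xy; apply: vv; rewrite eq_sym xy.
- move=> x phi IH v v' vv; apply: funext => w.
  apply: eq_forall => d; congr (_ w); apply: IH => y yp.
  by rewrite /upd; case: eqVneq => // xy; apply: vv; rewrite eq_sym xy.
Qed.

Lemma force_upd_notfree v x d phi : ~~ free x phi ->
  force (upd v x d) phi = force v phi.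
Proof.
move=> nx; apply: force_ext => y yp; rewrite /upd; case: eqP => // xy.
by rewrite xy yp in nx.
Qed.

Lemma force_subst v t x phi : free_for t x phi ->
  force v (subst t x phi) = force (upd v x (eval app v t)) phi.
Proof.
elim: phi v => //=.
- by move=> u u' v _; rewrite !eval_tsubst.
- move=> R ts v _; congr rel; apply: funext => k; exact: eval_tsubst.
- by move=> phi IH1 psi IH2 v /andP[f1 f2]; rewrite IH1 // IH2.
- by move=> phi IH1 psi IH2 v /andP[f1 f2]; rewrite IH1 // IH2.
- by move=> phi IH1 psi IH2 v /andP[f1 f2]; rewrite IH1 // IH2.
- move=> y phi IH v; case: (eqVneq x y) => [<- _|xy /=].
    congr dneg; apply: funext => w.
    by apply: eq_exists => d; rewrite upd_upd.
  (* Either [y] does not occur in [t], whose value then ignores the update at [y], or [x] is not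
     free and both sides ignore the substitution. *)
  case: (boolP (free x phi)) => [_ /andP[yt ff]|nx _]; congr dneg;
    apply: funext => w; apply: eq_exists => d; rewrite updC //.
    rewrite IH //; congr (force (upd _ _ _) _ _); apply: eval_ext => z zt.
    by rewrite /upd; case: eqP => // yz; rewrite yz zt in yt.
  by rewrite subst_notfree // (force_upd_notfree _ _ nx).
- move=> y phi IH v; case: (eqVneq x y) => [<- _|xy /=].
    by apply: funext => w; apply: eq_forall => d; rewrite upd_upd.
  case: (boolP (free x phi)) => [_ /andP[yt ff]|nx _];
    apply: funext => w; apply: eq_forall => d; rewrite updC //.
    rewrite IH //; congr (force (upd _ _ _) _ _); apply: eval_ext => z zt.
    by rewrite /upd; case: eqP => // yz; rewrite yz zt in yt.
  by rewrite subst_notfree // (force_upd_notfree _ _ nx).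
Qed.

(** Classical rules and eliminations rest on [force_stable]; in the quantifier rules the
    eigenvariable takes an arbitrary value, which leaves the assumptions forced because it is not
    free in them. *)
Lemma force_sound (wf : formula S V -> Prop) (inst : V -> term S V -> Prop)
    (Gamma : set (formula S V)) phi :
  nd wf inst Gamma phi ->
  forall v w, (forall psi, Gamma psi -> force v psi w) -> force v phi w.
Proof.
have ext v psi0 G w w' : (forall psi, G psi -> force v psi w) -> le w w' ->
    force v psi0 w' -> forall psi, (psi0 |` G) psi -> force v psi w'.
  by move=> Gw l p psi [->//|/Gw]; apply: force_mono.
have updG v x d (G : set (formula S V)) w :
    (forall psi, G psi -> ~~ free x psi) ->
    (forall psi, G psi -> force v psi w) ->
    forall psi, G psi -> force (upd v x d) psi w.
  by move=> nG Gw psi Gp; rewrite force_upd_notfree ?nG //; apply: Gw.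
(* Giving the eigenvariable [y] the value [d] amounts to giving it to [x], since either [y] is [x]
   or [y] is not free in [psi]. *)
have subE v x y d psi :
    free_for (tVar y) x psi -> ~~ ((y != x) && free y psi) ->
    force (upd v y d) (subst (tVar y) x psi) = force (upd v x d) psi.
  move=> ff ny; rewrite force_subst //= upd_eq.
  apply: force_ext => z zp; rewrite /upd; case: (eqVneq x z) => // xz.
  by case: (eqVneq y z) => // yz; rewrite yz zp eq_sym xz in ny.
elim=> {Gamma phi}.
- by move=> G phi _ Gp v w; apply.
- by move=> G D' phi sub _ IH v w Gw; apply: IH => psi /sub /Gw.
- by move=> G phi psi _ _ IH1 _ IH2 v w Gw; split; [apply: IH1|apply: IH2].
- by move=> G phi psi _ _ IH v w /IH[].
- by move=> G phi psi _ _ IH v w /IH[].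
- move=> G phi psi _ _ IH v w /IH p w' l k; apply: k (le_refl _) _; left.
  exact: force_mono p.
- move=> G phi psi _ _ IH v w /IH p w' l k; apply: k (le_refl _) _; right.
  exact: force_mono p.
- move=> G phi psi chi _ _ IH0 _ IH1 _ IH2 v w Gw; apply: force_stable.
  apply: dneg_sub (IH0 v w Gw) => w' l [p|p]; [apply: IH1|apply: IH2];
  exact: ext _ _ _ _ _ Gw l p.
- by move=> G phi psi _ _ IH v w Gw w' l p; apply: IH;
  apply: ext _ _ _ _ _ Gw l p.
- by move=> G phi psi _ _ IH1 _ IH2 v w Gw; apply: (IH1 v w) => //; apply: IH2.
- by move=> G phi _ _ IH v w Gw; apply: force_pole; apply: (IH v w).
- move=> G phi _ _ IH v w Gw; apply: force_stable => w' l k.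
  by apply: (IH v); apply: ext _ _ _ _ _ Gw l _.
- move=> G x y phi _ _ ff nG /= ny _ IH v w Gw d.
  by rewrite -(subE _ _ y) //; apply: IH; apply: updG.
- by move=> G x t phi _ _ ff _ IH v w Gw; rewrite force_subst //; apply: IH.
- move=> G x t phi _ _ ff _ IH v w /IH; rewrite force_subst // => p w' l k.
  by apply: k (le_refl _) _; exists (eval app v t); apply: force_mono p.
- move=> G x y phi chi _ _ ff nG /= ny nc _ IH1 _ IH2 v w Gw.
  apply: force_stable; apply: dneg_sub (IH1 v w Gw) => w' l [d].
  rewrite -(subE _ _ y) // -(force_upd_notfree v d nc) => p.
  by apply: IH2; apply: ext _ _ _ _ _ _ l p; apply: updG.
Qed.

(** For the empty list the formula is [psi] alone, and the two directions become monotonicity and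
    reflexivity of the order. *)
Lemma force_conj_imp (I : eqType) (G : I -> formula S V) s psi v w :
  force v (conj_imp (map G s) psi) w <->
  (forall w', le w w' -> {in s, forall k, force v (G k) w'} -> force v psi w').
Proof.
case: s => [|a s] /=.
  by split=> [p w' l _|]; [apply: force_mono p|apply].
have fE chi w' : force v (foldl (@fAnd S V) chi (map G s)) w' <->
    force v chi w' /\ {in s, forall k, force v (G k) w'}.
  elim: s chi => [|b s IH] chi /=; first by split=> [|[]].
  rewrite IH /=; split=> [[[p q] h]|[p h]].
    by split=> // k; rewrite inE => /predU1P[->|/h].
  by split=> [|k ks]; [split=> //|]; apply: h; rewrite inE ?eqxx ?ks ?orbT.
split=> h w' l.
  move=> k; apply: h => //; rewrite fE; split=> [|b bs];
  by apply: k; rewrite inE ?eqxx ?bs ?orbT.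
by rewrite fE => -[p q]; apply: h => // k; rewrite inE => /predU1P[->|/q].
Qed.

Lemma force_closure phi chi : (forall v w, force v phi w) -> closures phi chi ->
  forall v w, force v chi w.
Proof. by move=> p [xs [_ _ ->]]; elim: xs => //= x xs IH v w d. Qed.

Lemma force_eq_axioms chi : @fol_eq_axioms S V chi ->
  forall v w, force v chi w.
Proof.
have imE n (G : 'I_n -> formula S V) psi v w :
    (forall w', (forall k, force v (G k) w') -> force v psi w') ->
    force v (conj_imp [seq G k | k : 'I_n] psi) w.
  move=> h; rewrite force_conj_imp => w' _ k; apply: h => i; apply: k.
  exact: mem_enum.
(* The pole may be the reason for any one of the component equations; deciding it first makes the
   remaining ones genuine identities. *)
have eqE n (a b : 'I_n -> D) w :
    (forall k, a k = b k \/ pole w) -> a = b \/ pole w.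
  move=> ab; case: (pselect (pole w)) => [|np]; first by right.
  by left; apply: funext => k; case: (ab k).
case=> phi m; apply: force_closure => {chi}; case: m => /=.
- by move=> x v w; left.
- by move=> x y v w w' _ [|]; [left|right].
- by move=> x y z v w w' _ [[->|p] [yz|q]]; [left|right|right|right].
- move=> R xs ys v w; apply: imE => w' /= h.
  move: (eqE _ _ _ _ h) => [->//|p] w1 l _.
  by apply: (@force_pole v (fRel R (fun k => tVar (ys k)))); apply: pole_mono p.
- move=> f xs ys v w; apply: imE => w' /= h.
  by move: (eqE _ _ _ _ h) => [->//|p]; [left|right].
Qed.

End Forcing.

(** * Variable indices and avoidance of capture *)

Section IndexBounds.
Variables (L : msig) (S : usig).
Implicit Types (x y : mvar L) (t : term S (mvar L)) (phi : formula S (mvar L)).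

Fixpoint tbound t : nat :=
  match t with
  | tVar x => x.2.+1
  | tApp f ts => \max_k tbound (ts k)
  end.

(** A strict bound on indices that also counts quantified variables, since these are the ones that
    could capture. *)
Fixpoint ibound phi : nat :=
  match phi with
  | fBot => 0
  | fEq t u => maxn (tbound t) (tbound u)
  | fRel R ts => \max_k tbound (ts k)
  | fAnd phi psi | fOr phi psi | fImp phi psi => maxn (ibound phi) (ibound psi)
  | fEx x phi | fAll x phi => maxn x.2.+1 (ibound phi)
  end.

Lemma occurs_tbound x t : occurs x t -> x.2 < tbound t.
Proof.
elim: t => /= [y /eqP ->//|f ts IH /existsP[k /IH]].
by move/leq_trans; apply; apply: (leq_bigmax k).
Qed.

Lemma free_ibound x phi : free x phi -> x.2 < ibound phi.
Proof.
elim: phi => //=.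
- by move=> t u; rewrite leq_max => /orP[]/occurs_tbound ->; rewrite ?orbT.
- move=> R ts /existsP[k /occurs_tbound]/leq_trans; apply.
  exact: (leq_bigmax k).
- by move=> ? IH1 ? IH2; rewrite leq_max => /orP[/IH1|/IH2] ->; rewrite ?orbT.
- by move=> ? IH1 ? IH2; rewrite leq_max => /orP[/IH1|/IH2] ->; rewrite ?orbT.
- by move=> ? IH1 ? IH2; rewrite leq_max => /orP[/IH1|/IH2] ->; rewrite ?orbT.
- by move=> y phi IH /andP[_ /IH]; rewrite leq_max => ->; rewrite orbT.
- by move=> y phi IH /andP[_ /IH]; rewrite leq_max => ->; rewrite orbT.
Qed.

Lemma notfree_ibound x phi : ibound phi <= x.2 -> ~~ free x phi.
Proof. by apply: contraTN => /free_ibound; rewrite -ltnNge. Qed.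

Definition high N t := forall x, occurs x t -> N <= x.2.

(** [msubst] keeps the binders of [phi], all of index below [N], whereas the variables of [t] have
    index at least [N]. *)
Lemma free_for_msubst N t x v phi : high N t -> ibound phi <= N ->
  free_for t x (msubst v phi).
Proof.
move=> ht; elim: phi v => //=.
- by move=> ? IH1 ? IH2 v; rewrite geq_max => /andP[/IH1 -> /IH2 ->].
- by move=> ? IH1 ? IH2 v; rewrite geq_max => /andP[/IH1 -> /IH2 ->].
- by move=> ? IH1 ? IH2 v; rewrite geq_max => /andP[/IH1 -> /IH2 ->].
- move=> y phi IH v; rewrite geq_max => /andP[yN /IH ->]; rewrite andbT.
  by apply/orP; right; apply/negP => /ht; rewrite leqNgt yN.
- move=> y phi IH v; rewrite geq_max => /andP[yN /IH ->]; rewrite andbT.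
  by apply/orP; right; apply/negP => /ht; rewrite leqNgt yN.
Qed.

End IndexBounds.

(** * Sorts and index bounds under substitution and translation *)

Section Sorts.
Variable L : msig.
Implicit Types (x y : mvar L) (t : term L (mvar L)) (phi : formula L (mvar L)).
Implicit Types (v : mvar L -> term L (mvar L)).

Lemma has_sort_tmsubst v t i : (forall x, has_sort (v x) x.1) ->
  has_sort t i -> has_sort (tmsubst v t) i.
Proof.
move=> vs; elim=> {t i} [x|f ts js i fr _ IH]; first exact: vs.
by apply: has_sort_app fr _ => k; apply: IH.
Qed.

Lemma has_sort_upd v x t : (forall y, has_sort (v y) y.1) -> has_sort t x.1 ->
  forall y, has_sort (upd v x t y) y.1.
Proof. by move=> vs tx y; rewrite /upd; case: eqP => [<-|]. Qed.

Lemma well_sorted_msubst v phi : (forall x, has_sort (v x) x.1) ->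
  well_sorted phi -> well_sorted (msubst v phi).
Proof.
elim: phi v => //=.
- move=> t u v vs [i [ti ui]]; exists i; split; exact: has_sort_tmsubst.
- move=> R ts v vs [js r h]; exists js => // k; exact: has_sort_tmsubst.
- by move=> ? IH1 ? IH2 v vs [/(IH1 _ vs) ? /(IH2 _ vs)].
- by move=> ? IH1 ? IH2 v vs [/(IH1 _ vs) ? /(IH2 _ vs)].
- by move=> ? IH1 ? IH2 v vs [/(IH1 _ vs) ? /(IH2 _ vs)].
- move=> x phi IH v vs; apply: IH; apply: has_sort_upd => //.
  exact: has_sort_var.
- move=> x phi IH v vs; apply: IH; apply: has_sort_upd => //.
  exact: has_sort_var.
Qed.

(** The guards added by [star] only mention variables already counted at their quantifiers. Hence
    cutting down the translated assumptions bounds the original ones. *)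
Lemma ibound_star phi : ibound (star phi) = ibound phi.
Proof.
have bQ y : \max_(k < 1) (tbound (tVar y : term L (mvar L))) = y.2.+1.
  by rewrite big_ord1.
elim: phi => //= [? -> ? ->|? -> ? ->|? -> ? ->|y phi ->|y phi ->] //.
  by rewrite bQ maxnA maxnn.
by rewrite bQ maxnA maxnn.
Qed.

End Sorts.

(** * The syntactic forcing model *)

Section Canonical.
Variables (L : msig) (Gamma : set (formula L (mvar L))) (N : nat).
Hypothesis Gamma_sentence : forall psi, Gamma psi -> sentence psi.
Notation form := (formula L (mvar L)).
Implicit Types (x y : mvar L) (t : term L (mvar L)) (phi psi chi : form).
Implicit Types (w : seq form) (v : mvar L -> term L (mvar L)).

Definition ctx w : set form := Gamma `|` [set psi | List.In psi w].
Definition prov w phi : Prop :=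
  nd (@well_sorted L) (fun x t => has_sort t x.1) (ctx w) phi.
Definition ext w w' : Prop := List.incl w w'.
Definition pole w : Prop := prov w fBot.

(* A term only counts as an element of a sort if its variables cannot be
   captured by the bound variables, all of index below [N]. *)
Definition canon_rel (R : relsym (star_sig L)) :
    ('I_(rarity R) -> term L (mvar L)) -> seq form -> Prop :=
  match R return
    ('I_(@rarity (star_sig L) R) -> term L (mvar L)) -> seq form -> Prop with
  | inl R => fun ts w => prov w (fRel R ts) \/ pole w
  | inr i => fun ts w => (has_sort (ts ord0) i /\ high N (ts ord0)) \/ pole w
  end.

Lemma ext_refl w : ext w w. Proof. exact: List.incl_refl. Qed.

Lemma ext_trans w1 w2 w3 : ext w1 w2 -> ext w2 w3 -> ext w1 w3.
Proof. exact: List.incl_tran. Qed.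

Lemma prov_mono w w' phi : ext w w' -> prov w phi -> prov w' phi.
Proof.
by move=> l; apply: nd_weak => psi [Gp|/l wp]; [left|right].
Qed.

Lemma ctx_consV w phi : ctx (phi :: w) `<=` phi |` ctx w.
Proof. by move=> psi [Gp|[->|wp]]; [right; left|left|right; right]. Qed.

Lemma ext_cons w phi : ext w (phi :: w).
Proof. by move=> psi wp; right. Qed.

Lemma prov_ass w phi : well_sorted phi -> List.In phi w -> prov w phi.
Proof. by move=> wp pw; apply: nd_ass => //; right. Qed.

Lemma prov_raa w phi : well_sorted phi -> pole (fNot phi :: w) -> prov w phi.
Proof.
by move=> wp h; apply: nd_raa => //; apply: nd_weak h; apply: ctx_consV.
Qed.

Lemma prov_absurd w phi : List.In (fNot phi) w -> well_sorted phi ->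
  prov w phi -> pole w.
Proof.
by move=> nw wp; apply: nd_impE => //; apply: prov_ass.
Qed.

Lemma canon_rel_mono R ts w w' :
  ext w w' -> @canon_rel R ts w -> @canon_rel R ts w'.
Proof.
move=> l; case: R ts => [R|i] ts /= [h|h]; try by right; apply: prov_mono h.
  by left; apply: prov_mono h.
by left.
Qed.

(** For sort predicates only the pole depends on the world, so the rest is decided classically. For
    the original relation symbols, regularity is reductio ad absurdum in MSL. *)
Lemma canon_rel_stable R ts w :
  dneg ext pole (@canon_rel R ts) w -> @canon_rel R ts w.
Proof.
case: R ts => [R|i] ts /= h; last first.
  case: (pselect (has_sort (ts ord0) i /\ high N (ts ord0))); first by left.
  by move=> n; right; apply: h (@ext_refl _) _ => w' _ [].
case: (pselect (well_sorted (fRel R ts))) => wR.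
  (* At the world extended by the negated atom, any later derivation of the atom is inconsistent, so
     that world lies in the pole. *)
  left; apply: prov_raa => //; apply: h (@ext_cons _ _) _ => w' l [p|//].
  by apply: (prov_absurd _ wR p); apply: l; left.
(* An ill-sorted atom is never derivable, so it can be forced only through the pole. *)
right; apply: h (@ext_refl _) _ => w' _ [/nd_wf //|//].
Qed.

Notation cforce := (@force (star_sig L) (mvar L) _ (@tApp L (mvar L)) _
  ext pole canon_rel).

Lemma canon_pole_mono w w' : ext w w' -> pole w -> pole w'.
Proof. exact: prov_mono. Qed.

(** A world is finite, so the indices of its formulas have a common bound [K], and each sort has
    variables of arbitrarily large index. *)
Lemma fresh i M w : exists y,
  [/\ y.1 = i, M <= y.2 & forall psi, List.In psi w -> ~~ free y psi].
Proof.
have [K hK] : exists K, forall psi, List.In psi w -> ibound psi <= K.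
  elim: w => [|a w [K hK]]; first by exists 0.
  exists (maxn (ibound a) K) => psi /= [<-|/hK h]; first exact: leq_maxl.
  by rewrite leq_max h orbT.
exists (i, maxn M K); split=> //=; first exact: leq_maxl.
by move=> psi /hK h; apply: notfree_ibound; rewrite /= leq_max h orbT.
Qed.

Definition high_val v := forall x, has_sort (v x) x.1 /\ high N (v x).

Lemma high_val_upd v x t : high_val v -> has_sort t x.1 -> high N t ->
  high_val (upd v x t).
Proof. by move=> hv ts ht y; rewrite /upd; case: eqP => [<-|]. Qed.

Lemma high_tVar y : N <= y.2 -> high N (tVar y : term L (mvar L)).
Proof. by move=> h x /= /eqP ->. Qed.

Lemma subst_high v x t phi : high_val v -> x.2 < N ->
  subst t x (msubst (upd v x (tVar x)) phi) = msubst (upd v x t) phi.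
Proof.
move=> hv xN; apply: subst_msubst => z _; apply/negP => /(hv z).2.
by rewrite leqNgt xN.
Qed.

Lemma well_sorted_upd v x phi : high_val v -> well_sorted phi ->
  well_sorted (msubst (upd v x (tVar x)) phi).
Proof.
move=> hv; apply: well_sorted_msubst; apply: has_sort_upd.
  by move=> y; case: (hv y).
exact: has_sort_var.
Qed.

Lemma fresh_var v x phi w : exists y,
  [/\ y.1 = x.1, high N (tVar y : term L (mvar L)),
    forall psi, ctx w psi -> ~~ free y psi
    & ~~ free y (msubst v phi)].
Proof.
(* Adding the formula to the world makes [y] fresh for it as well; [Gamma] consists of sentences and
   imposes no condition. *)
have [y [yx yN yw]] := fresh x.1 N (msubst v phi :: w).
exists y; split; [by []|exact: high_tVar| |by apply: yw; left].
by move=> psi [/Gamma_sentence|pw]; [apply|apply: yw; right].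
Qed.

(** The truth lemma of the model. Equations are excluded because they are interpreted by identity of
    terms, which derivable equality need not imply. *)
Lemma force_star v phi w : high_val v -> well_sorted phi -> eq_free phi ->
  ibound phi <= N -> cforce v (star phi) w <-> prov w (msubst v phi).
Proof.
have fpole u (psi : formula (star_sig L) (mvar L)) w' :
    pole w' -> cforce u psi w'.
  exact: force_pole (@ext_refl) (@ext_trans) canon_pole_mono canon_rel_mono
    canon_rel_stable _ _ _.
have vs u : high_val u -> forall x, has_sort (u x) x.1.
  by move=> hu x; case: (hu x).
have sub (u : mvar L -> term L (mvar L)) x y psi : high_val u -> x.2 < N ->
  msubst (upd u x (tVar y)) psi =
  subst (tVar y) x (msubst (upd u x (tVar x)) psi).
  by move=> hu xN; rewrite subst_high.
elim: phi v w => //=.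
- move=> R ts v w hv wR _ _; split=> [[//|p]|]; last by left.
  apply: nd_botE p; exact: (@well_sorted_msubst _ _ (fRel R ts) (vs _ hv) wR).
- move=> phi IH1 psi IH2 v w hv [w1 w2] /andP[e1 e2].
  rewrite geq_max => /andP[b1 b2].
  rewrite IH1 // IH2 //; split=> [[p q]|p].
    by apply: nd_andI => //; split; apply: well_sorted_msubst => //; exact: vs.
  split; [apply: nd_andEl p|apply: nd_andEr p];
    apply: well_sorted_msubst => //; exact: vs.
- move=> phi IH1 psi IH2 v w hv [w1 w2] /andP[e1 e2].
  rewrite geq_max => /andP[b1 b2].
  have m1 := well_sorted_msubst (vs _ hv) w1.
  have m2 := well_sorted_msubst (vs _ hv) w2.
  split=> [h|p w' l k].
    (* The world is extended by the negated disjunction; wherever a disjunct becomes derivable, this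
       negation is contradicted, so the [dneg] yields the pole. *)
    apply: prov_raa => //; apply: h (@ext_cons _ _) _ => w' l.
    rewrite IH1 // IH2 // => -[p|p];
      (apply: (@prov_absurd w' (fOr (msubst v phi) (msubst v psi))) => //;
       first by apply: l; left).
      exact: nd_orIl.
    exact: nd_orIr.
  (* In each case the world is extended by the disjunct at hand, and [k] shows the result to be
     inconsistent. *)
  apply: nd_orE (prov_mono l p) _ _ => //.
    apply: nd_weak (@ctx_consV _ _) (k _ (@ext_cons _ _) _).
    by left; rewrite IH1 //; apply: prov_ass => //; left.
  apply: nd_weak (@ctx_consV _ _) (k _ (@ext_cons _ _) _).
  by right; rewrite IH2 //; apply: prov_ass => //; left.
- move=> phi IH1 psi IH2 v w hv [w1 w2] /andP[e1 e2].
  rewrite geq_max => /andP[b1 b2].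
  have m1 := well_sorted_msubst (vs _ hv) w1.
  have m2 := well_sorted_msubst (vs _ hv) w2.
  split=> [h|p w' l].
    apply: nd_impI => //; apply: nd_weak (@ctx_consV _ _) _.
    by rewrite -/(prov _ _) -IH2 //; apply: h (@ext_cons _ _) _; rewrite IH1 //;
      apply: prov_ass => //; left.
  by rewrite IH1 // IH2 //; apply: nd_impE => //; apply: prov_mono p.
- move=> x phi IH v w hv w1 e1; rewrite geq_max => /andP[xN b1].
  have wx := well_sorted_upd x hv w1.
  split=> [h|p w' l k].
    apply: prov_raa => //; apply: h (@ext_cons _ _) _ => w' l [t [+ p]].
    (* Outside the pole, the guard makes the witness [t] a term that existential introduction
       accepts. *)
    rewrite upd_eq => -[[ts ht]|//].
    have hvt := high_val_upd hv ts ht.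
    apply: (@prov_absurd w' (fEx x (msubst (upd v x (tVar x)) phi))) => //.
      by apply: l; left.
    apply: (@nd_exI L (mvar L) _ _ _ x t) => //;
      first exact: free_for_msubst ht b1.
    by rewrite subst_high //; apply/IH.
  (* The eigenvariable of existential elimination is itself the forced witness, at the world
     extended by its instance. *)
  have [y [yx yN yc yp]] := fresh_var v x (fEx x phi) w'.
  have ys : has_sort (tVar y : term L (mvar L)) x.1.
    by rewrite -yx; apply: has_sort_var.
  have hvy := high_val_upd hv ys yN.
  apply: (@nd_exE L (mvar L) _ _ _ _ _ _ _ _ ys _ yc yp _ (prov_mono l p)) => //;
      first exact: free_for_msubst yN b1.
  apply: nd_weak (@ctx_consV _ _) (k _ (@ext_cons _ _) _).
  exists (tVar y); split; first by left; rewrite /= upd_eq.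
  rewrite IH // -sub // ; apply: prov_ass; last by left.
  by apply: well_sorted_msubst => //; apply: vs.
- move=> x phi IH v w hv w1 e1; rewrite geq_max => /andP[xN b1].
  have wx := well_sorted_upd x hv w1.
  split=> [h|p t w' l [[]|]].
  (* The universal is evaluated at a fresh high variable, which then serves as the eigenvariable. *)
  + have [y [yx yN yc yp]] := fresh_var v x (fAll x phi) w.
    have ys : has_sort (tVar y : term L (mvar L)) x.1.
      by rewrite -yx; apply: has_sort_var.
    have hvy := high_val_upd hv ys yN.
    apply: (@nd_allI L (mvar L) _ _ _ _ _ _ _ ys _ yc yp) => //;
      first exact: free_for_msubst yN b1.
    rewrite -sub //; apply/IH => //; apply: (h (tVar y) w (@ext_refl _)).
    by left; rewrite /= upd_eq.
  + rewrite /= upd_eq => ts ht.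
    have hvt := high_val_upd hv ts ht.
    rewrite IH // -(subst_high _ _ hv xN).
    apply: (@nd_allE L (mvar L) _ _ _ _ _ _ _ _ _ (prov_mono l p)) => //;
      last exact: free_for_msubst ht b1.
    by rewrite subst_high //; apply: well_sorted_msubst => //; apply: vs.
  (* In the pole the guard holds of every term, well-sorted or not, but there every formula is
     forced. *)
  + exact: fpole.
Qed.

Lemma force_Gamma v w psi : high_val v -> Gamma psi -> well_sorted psi ->
  eq_free psi -> ibound psi <= N -> cforce v (star psi) w.
Proof.
move=> hv Gp wp ep bp; rewrite force_star // msubst_sentence;
  last exact: Gamma_sentence.
by apply: nd_ass => //; left.
Qed.

Lemma force_J (chi : formula (star_sig L) (mvar L)) :
  @J L chi -> forall v w, cforce v chi w.
Proof.
case=> phi m; apply: force_closure => {chi}; case: m.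
  move=> i x v w w' l k; apply: k (@ext_refl _) _.
  (* [N] is the least index of a high variable. *)
  exists (svar i N); left; rewrite /= upd_eq; split; first exact: has_sort_var.
  exact: high_tVar.
move=> f js i xs fr v w.
rewrite (force_conj_imp (S := star_sig L) _ ext_refl ext_trans canon_pole_mono
  canon_rel_mono) => w' _ h.
case: (pselect (pole w')) => [p|np]; first by right.
have {}h k : has_sort (v (xs k)) (js k) /\ high N (v (xs k)).
  by case: (h k (mem_enum _ _)).
left; split=> /=; first by apply: has_sort_app fr _ => k; case: (h k).
by move=> x /= /existsP[k]; case: (h k) => _; apply.
Qed.

End Canonical.

(** Soundness is applied at the empty world, where forcing [star phi] means deriving [phi] from
    [Gamma]. *)
Lemma fol_to_msl (L : msig) (Gamma : set (formula L (mvar L)))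
    (phi : formula L (mvar L)) :
  (forall psi, (Gamma `|` [set phi]) psi ->
     [/\ well_sorted psi, sentence psi & eq_free psi]) ->
  fol_provable ([set star gamma | gamma in Gamma] `|` @J L) (star phi) ->
  msl_provable Gamma phi.
Proof.
(* The bound is raised to cover [phi] too, so that the truth lemma applies to the conclusion. *)
move=> hs /(nd_bounded (@ibound L _)) [N0 /(_ _ (leq_maxl N0 (ibound phi)))].
set N := maxn _ _ => H.
have hG psi : Gamma psi -> sentence psi.
  by move=> Gp; have [] : [/\ _, _ & _] := hs psi (or_introl Gp).
have [wp sp ep] := hs phi (or_intror erefl).
(* Any sort-preserving high valuation would serve, since [phi] and the members of [Gamma] are
   sentences. *)
pose v (x : mvar L) := svar x.1 N.
have hv : high_val N v.
  by move=> x; split; [exact: has_sort_var|exact: high_tVar].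
have := force_sound (S := star_sig L) (app := @tApp L (mvar L)) (@ext_refl L)
  (@ext_trans L) (@canon_pole_mono L Gamma) (@canon_rel_mono L Gamma N)
  (@canon_rel_stable L Gamma N) H (v := v) (w := [::]).
rewrite force_star // ?leq_maxr // msubst_sentence // => K.
apply: nd_weak (K _) => [psi [Gp|[]]|psi [[[[gamma Gg <-]|Jp]|Ep] bp]].
- by left.
- have [wg sg eg] := hs gamma (or_introl Gg).
  by apply: force_Gamma => //; rewrite -ibound_star.
- exact: force_J.
- exact: (force_eq_axioms (S := star_sig L) (@tApp L (mvar L)) (@ext_refl L)
    (@ext_trans L) (@canon_pole_mono L Gamma) (@canon_rel_mono L Gamma N)
    (@canon_rel_stable L Gamma N) Ep).
Qed.

(** * Simultaneous instantiation of universal closures *)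

Section Instantiation.
Variables (S : usig) (V : eqType).
Implicit Types (x y z : V) (t : term S V) (phi psi : formula S V).

Fixpoint tvars t : seq V :=
  match t with
  | tVar x => [:: x]
  | tApp f ts => flatten [seq tvars (ts k) | k <- enum 'I_(farity f)]
  end.

Lemma msubst_conj_imp (I : eqType) (G : I -> formula S V) s psi v :
  msubst v (conj_imp (map G s) psi) =
  conj_imp (map (fun k => msubst v (G k)) s) (msubst v psi).
Proof.
case: s => //= a s; congr fImp.
by elim: s (G a) => //= b s IH chi; rewrite IH.
Qed.

Lemma free_for_conj_imp (I : eqType) (G : I -> formula S V) s psi t x :
  (forall k, free_for t x (G k)) -> free_for t x psi ->
  free_for t x (conj_imp (map G s) psi).
Proof.
move=> hG hp; case: s => //= a s; rewrite hp andbT.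
by elim: s (G a) (hG a) => //= b s IH chi hc; apply: IH; rewrite /= hc hG.
Qed.

Lemma subst_foldr_fAll t x xs phi : x \notin xs ->
  subst t x (foldr (@fAll S V) phi xs) = foldr (@fAll S V) (subst t x phi) xs.
Proof.
elim: xs => //= y xs IH; rewrite inE negb_or => /andP[/negPf -> /IH ->].
by [].
Qed.

Lemma free_for_foldr_fAll t x xs phi : (forall y, y \in xs -> ~~ occurs y t) ->
  free_for t x phi -> free_for t x (foldr (@fAll S V) phi xs).
Proof.
move=> h hp; elim: xs h => //= y xs IH h.
rewrite IH ?h ?inE ?eqxx ?orbT // => z zs.
by apply: h; rewrite inE zs orbT.
Qed.

Variables (wf : formula S V -> Prop) (inst : V -> term S V -> Prop).
Hypothesis wfT : forall phi, wf phi.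
Hypothesis instT : forall x t, inst x t.

Lemma nd_cut (Gamma : set (formula S V)) phi psi :
  nd wf inst (phi |` Gamma) psi -> nd wf inst Gamma phi -> nd wf inst Gamma psi.
Proof. by move=> h; apply: nd_impE => //; apply: nd_impI. Qed.

(** Quantifiers are removed one at a time, with [v] recording the substitutions already made. No
    variable of [xs] occurs in a substituted term, so later steps do not disturb earlier ones and
    the remaining quantifiers capture nothing. *)
Lemma nd_instantiate (sigma v : V -> term S V) xs psi
    (Gamma : set (formula S V)) :
  uniq xs -> (forall t x u, free_for t x (msubst u psi)) ->
  {in xs &, forall x z, ~~ occurs z (sigma x)} ->
  {in xs, forall x, v x = tVar x} ->
  (forall y, y \notin xs -> {in xs, forall x, ~~ occurs x (v y)}) ->
  nd wf inst Gamma (foldr (@fAll S V) (msubst v psi) xs) ->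
  nd wf inst Gamma (msubst (fun y => if y \in xs then sigma y else v y) psi).
Proof.
move=> + ff; elim: xs v => [|x xs IH] v /=.
  by move=> _ _ _ _; congr (nd _ _ _ _).
move=> /andP[xxs uxs] hs vx vn H.
(* Making it explicit that [v] fixes [x] gives the form in which [subst_msubst] composes the two
   substitutions. *)
have vE : msubst v psi = msubst (upd v x (tVar x)) psi.
  apply: msubst_ext => y _; rewrite /upd; case: eqP => // <-.
  by rewrite vx // inE eqxx.
have nocc y : y != x -> ~~ occurs x (v y).
  move=> yx; case: (boolP (y \in xs)) => [ys|yns].
    by rewrite vx /= 1?eq_sym // inE ys orbT.
  by apply: vn; rewrite inE ?eqxx // negb_or yx.
have {}H : nd wf inst Gamma
    (foldr (@fAll S V) (msubst (upd v x (sigma x)) psi) xs).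
  rewrite -subst_msubst // -subst_foldr_fAll // -vE; apply: nd_allE H => //.
  apply: free_for_foldr_fAll => // y ys.
  by apply: hs; rewrite inE ?eqxx ?ys ?orbT.
have -> : (fun y => if y \in x :: xs then sigma y else v y) =
    (fun y => if y \in xs then sigma y else upd v x (sigma x) y).
  apply: funext => y; rewrite inE /upd eq_sym.
  by case: eqP => [<-|] //=; case: ifP.
apply: IH H => //.
- by move=> y z ys zs; apply: hs; rewrite inE ?ys ?zs orbT.
- move=> y ys; rewrite /upd; case: eqP => [xy|_]; first by rewrite xy ys in xxs.
  by apply: vx; rewrite inE ys orbT.
- move=> y yns z zs; rewrite /upd; case: eqP => [_|/eqP xy].
    by apply: hs; rewrite inE ?eqxx ?zs ?orbT.
  by apply: vn; rewrite inE ?zs ?orbT // negb_or yns andbT eq_sym.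
Qed.

End Instantiation.

(** * Relativization of derivations *)

Section Relativization.
Variable L : msig.
Notation V := (mvar L).
Notation form := (formula L V).
Notation sform := (formula (star_sig L) V).
Implicit Types (x y : V) (t : term L V) (phi psi chi : form).
Implicit Types (G : set form) (X Y : seq V).

Lemma free_fQ x i t : free x (fQ i t) = occurs x t.
Proof. by apply/existsP/idP => [[]|e] //; exists ord0. Qed.

Lemma free_star x phi : free x (star phi) = free x phi.
Proof.
have fQE y : [exists k : 'I_1, x == y] = (x == y).
  exact: (@free_fQ x y.1 (tVar y)).
elim: phi => //= [? -> ? ->|? -> ? ->|? -> ? ->|y phi ->|y phi ->] //;
  by rewrite fQE; case: (x == y).
Qed.

Lemma star_subst t x phi :
  star (subst t x phi) = @subst (star_sig L) V t x (star phi).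
Proof.
elim: phi => //= [? -> ? ->|? -> ? ->|? -> ? ->|y phi IH|y phi IH] //;
  by case: eqP => // _; rewrite IH.
Qed.

Lemma free_for_star t x phi :
  @free_for (star_sig L) V t x (star phi) = free_for t x phi.
Proof.
elim: phi => //= [? -> ? ->|? -> ? ->|? -> ? ->|y phi IH|y phi IH] //;
  by have /= -> := free_star x (fEx y phi); rewrite IH.
Qed.

Lemma subst_fQ t x i : @subst (star_sig L) V t x (fQ i (tVar x)) = fQ i t.
Proof. by rewrite /fQ /= eqxx. Qed.

Lemma subst_fImp_fQ t x phi :
  @subst (star_sig L) V t x (fImp (fQ x.1 (tVar x)) (star phi)) =
  fImp (fQ x.1 t) (star (subst t x phi)).
Proof. by rewrite star_subst -(subst_fQ t x). Qed.

Lemma subst_fAnd_fQ t x phi :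
  @subst (star_sig L) V t x (fAnd (fQ x.1 (tVar x)) (star phi)) =
  fAnd (fQ x.1 t) (star (subst t x phi)).
Proof. by rewrite star_subst -(subst_fQ t x). Qed.

Lemma star_conj_imp (I : eqType) (F : I -> form) s psi :
  star (conj_imp (map F s) psi) =
  conj_imp (map (fun k => star (F k)) s) (star psi).
Proof.
case: s => //= a s; congr fImp.
by elim: s (F a) => //= b s IH chi; rewrite IH.
Qed.

Lemma star_eq_matrix phi : msl_eq_matrix phi -> fol_eq_matrix (star phi).
Proof.
case=> [i m|i m n|i m n p|R js ms ns _|f js i ms ns _].
- exact: (@fol_refl (star_sig L)).
- exact: (@fol_sym (star_sig L)).
- exact: (@fol_trans (star_sig L)).
- rewrite star_conj_imp.
  exact: (@fol_cong_rel (star_sig L) V (inl R) (fun k => (js k, ms k))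
    (fun k => (js k, ns k))).
- rewrite star_conj_imp.
  exact: (@fol_cong_fun (star_sig L) V f (fun k => (js k, ms k))
    (fun k => (js k, ns k))).
Qed.

Notation fnd := (@nd (star_sig L) V (fun=> True) (fun _ _ => True)).

(** An unrestricted universal quantifier implies its relativization: the guards are assumed and then
    ignored. *)
Lemma fnd_star_closure (phi : form) xs :
  fnd [set foldr (@fAll (star_sig L) V) (star phi) xs]
      (star (foldr (@fAll L V) phi xs)).
Proof.
elim: xs => [|x xs IH] /=; first exact: nd_ass.
set A := foldr _ (star phi) xs in IH *.
(* The eigenvariable can be [x] itself, as it is not free in the only assumption [fAll x A]. *)
apply: (@nd_allI (star_sig L) V _ _ _ x x) => //=.
- by rewrite free_for_id.
- by move=> psi -> /=; rewrite eqxx.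
- by rewrite eqxx.
rewrite -[fImp _ _]/(subst (tVar x) x (fImp (fQ x.1 (tVar x))
  (star (foldr (@fAll L V) phi xs)))) subst_id.
apply: nd_impI => //; apply: (@nd_weak _ _ _ _ _ [set fAll x A]).
  by move=> psi ->; right.
apply: (@nd_cut _ _ _ _ _ _ A) => //.
  by apply: nd_weak IH => psi ->; left.
suff: fnd [set fAll x A] (subst (tVar x) x A) by rewrite subst_id.
by apply: nd_allE => //; [exact: free_for_id|exact: nd_ass].
Qed.

Lemma fnd_eq_axioms phi : @msl_eq_axioms L phi ->
  fnd (@fol_eq_axioms (star_sig L) V) (star phi).
Proof.
move=> [psi m [xs [uxs fxs ->]]].
apply: nd_weak (fnd_star_closure _ _) => chi ->.
exists (star psi); first exact: star_eq_matrix.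
by exists xs; split=> // x; rewrite free_star.
Qed.

Definition sorting X : set sform :=
  [set chi | exists2 x, x \in X & chi = fQ x.1 (tVar x)].

(** By induction on the sorting of [t]: at an application, the closure in [J] for [f] is
    instantiated at the arguments, and its premises are the induction hypotheses. *)
Lemma fnd_sort t i X : has_sort t i -> {subset tvars t <= X} ->
  fnd (@J L `|` sorting X) (fQ i t).
Proof.
elim=> {t i} [x|f ts js i fr _ IH] /= sX.
  by apply: nd_ass => //; right; exists x => //; apply: sX; rewrite inE.
have {}IH k : fnd (@J L `|` sorting X) (fQ (js k) (ts k)).
  apply: IH => x xk; apply: sX; apply/flatten_mapP; exists k => //.
  exact: mem_enum.
(* Indices from [M] on do not occur in the arguments, so instantiation cannot capture; the offset
   [k] keeps variables of equal sort distinct. *)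
pose M := \max_k tbound (ts k).
pose x_ (k : 'I_(farity f)) : V := (js k, M + k).
have x_inj : injective x_ by move=> k l [_ /addnI /val_inj].
pose sigma y := if [pick k | x_ k == y] is Some k then ts k else tVar y.
have sigmaE k : sigma (x_ k) = ts k.
  by rewrite /sigma; case: pickP => [l /eqP/x_inj ->|/(_ k)] //; rewrite eqxx.
pose xs := [seq x_ k | k : 'I_(farity f)].
have xsP y : reflect (exists k, y = x_ k) (y \in xs).
  by apply: (iffP mapP) => [[k _ ->]|[k ->]]; exists k; rewrite ?mem_enum.
pose psi : sform := conj_imp [seq fQ (js k) (tVar (x_ k)) | k : 'I_(farity f)]
  (fQ i (tApp f (fun k => tVar (x_ k)))).
set C := _ `|` _ in IH *; pose w y := if y \in xs then sigma y else tVar y.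
have wE k : w (x_ k) = ts k.
  by rewrite /w sigmaE; case: xsP => // -[]; exists k.
have wQ : @msubst (star_sig L) V w psi =
    conj_imp [seq fQ (js k) (ts k) | k : 'I_(farity f)] (fQ i (tApp f ts)).
  rewrite msubst_conj_imp; congr conj_imp.
    by apply: eq_map => k; rewrite -wE.
  by rewrite -(funext wE).
suff: fnd C (@msubst (star_sig L) V w psi).
  by rewrite wQ => /nd_conj_impE; apply.
apply: nd_instantiate => //.
- by rewrite map_inj_uniq ?enum_uniq.
- by move=> t x u; rewrite msubst_conj_imp free_for_conj_imp.
- move=> _ _ /xsP[k ->] /xsP[l ->]; rewrite sigmaE.
  apply/negP => /occurs_tbound /=; rewrite ltnNge => /negP; apply.
  by apply: leq_trans (leq_addr _ _); apply: (leq_bigmax k).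
- by move=> y yns x xs' /=; apply: contraNN yns => /eqP <-.
rewrite msubst_tVar; apply: nd_ass => //; left; exists psi.
  exact: J_fun.
exists xs; split=> [|x|//]; first by rewrite map_inj_uniq ?enum_uniq.
rewrite free_conj_imp free_fQ /=; apply/xsP/orP.
  by case=> k ->; right; apply/existsP; exists k.
case=> [/hasP[k _]|/existsP[k /eqP ->]]; last by exists k.
by move=> /existsP[_ /eqP ->]; exists k.
Qed.

(* The sorted equality axioms are left out, their translations being derivable
   from the unsorted ones. *)
Definition relativized G X : set sform :=
  [set star psi | psi in G `\` @msl_eq_axioms L] `|`
  (@J L `|` @fol_eq_axioms (star_sig L) V) `|` sorting X.

Lemma relativized_sub G G' X X' : G `<=` G' -> {subset X <= X'} ->
  relativized G X `<=` relativized G' X'.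
Proof.
move=> sG sX chi [[[psi [Gp np] <-]|Tp]|[x xX ->]].
- by left; left; exists psi => //; split=> //; apply: sG.
- by left; right.
- by right; exists x => //; apply: sX.
Qed.

Lemma relativizedU1 phi G X :
  relativized (phi |` G) X `<=` star phi |` relativized G X.
Proof.
move=> chi [[[psi [[->|Gp] np] <-]|Tp]|Xp]; first by left.
- by right; left; left; exists psi.
- by right; left; right.
- by right; right.
Qed.

Lemma relativized_cons y G X :
  relativized G (y :: X) `<=` fQ y.1 (tVar y) |` relativized G X.
Proof.
move=> chi [Tp|[x + ->]]; first by right; left.
by rewrite inE => /predU1P[->|xX]; [left|right; right; exists x].
Qed.

Lemma J_sentence (chi : sform) : @J L chi -> sentence chi.
Proof. by case=> phi _ /closures_sentence. Qed.

Lemma relativized_notfree y G X : (forall psi, G psi -> ~~ free y psi) ->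
  y \notin X -> forall chi : sform, relativized G X chi -> ~~ free y chi.
Proof.
move=> nG yX chi
  [[[psi [/nG np _] <-]|[/J_sentence|[phi _ /closures_sentence]]]|].
- by rewrite free_star.
- exact.
- exact.
- case=> x xX ->; rewrite free_fQ /=; by apply: contraNneq yX => ->.
Qed.

(** [J] makes the sort of [y] inhabited, and existential elimination with eigenvariable [y]
    discharges the assumption. *)
Lemma fnd_drop (C : set sform) y (chi : sform) : @J L `<=` C ->
  (forall psi : sform, C psi -> ~~ free y psi) -> ~~ free y chi ->
  fnd (fQ y.1 (tVar y) |` C) chi -> fnd C chi.
Proof.
move=> JC nC nchi H.
apply: (@nd_exE (star_sig L) V _ _ _ y y (fQ y.1 (tVar y))) => //.
- by rewrite /= eqxx.
- apply: nd_ass => //; apply: JC; exists (fEx y (fQ y.1 (tVar y))).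
    exact: J_nonempty.
  (* The nonemptiness axiom is already a sentence, so its closure adds no quantifier. *)
  exists [::]; split=> // x; rewrite -[free _ _]/(_ && free x (fQ _ _)) free_fQ.
  by rewrite /= andNb.
- by rewrite subst_id.
Qed.

Lemma fnd_drop_sorting (C : set sform) X (chi : sform) : @J L `<=` C ->
  (forall psi : sform, C psi -> sentence psi) -> sentence chi ->
  fnd (C `|` sorting X) chi -> fnd C chi.
Proof.
move=> JC sC schi; elim: X => [|x X IH] H.
  by apply: nd_weak H => psi [//|[]].
apply: IH; case: (boolP (x \in X)) => [xX|xnX].
  (* A repeated variable contributes no new assumption. *)
  apply: nd_weak H => psi [|[y + ->]]; first by left.
  by rewrite inE => /predU1P[->|yX]; right; [exists x|exists y].
apply: (@fnd_drop _ x) => //.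
- by move=> psi /JC; left.
- move=> psi [/sC //|[y yX ->]]; rewrite free_fQ /=.
  by apply: contraNneq xnX => ->.
apply: nd_weak H => psi [Cp|[y + ->]]; first by right; left.
by rewrite inE => /predU1P[->|yX]; [left|right; right; exists y].
Qed.

Lemma has_sort_tVar y i : has_sort (tVar y : term L V) i -> y.1 = i.
Proof. by move=> h; inversion h. Qed.

(** [X] collects the variables of the terms used for instantiation, whose sorts must be assumed.
    Allowing every larger [Y] lets premises with different lists meet at a concatenation. *)
Lemma fnd_relativized G phi :
  nd (@well_sorted L) (fun x t => has_sort t x.1) G phi ->
  exists X, forall Y, {subset X <= Y} -> fnd (relativized G Y) (star phi).
Proof.
have subU X1 X2 Y : {subset X1 ++ X2 <= Y} ->
    {subset X1 <= Y} /\ {subset X2 <= Y}.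
  by move=> s; split=> x xX; apply: s; rewrite mem_cat xX ?orbT.
have rel1 chi D X (psi : sform) : fnd (relativized (chi |` D) X) psi ->
    fnd (star chi |` relativized D X) psi.
  by apply: nd_weak; apply: relativizedU1.
have JR D X : @J L `<=` relativized D X by move=> psi Jp; left; right; left.
have drop y D Y psi : (forall chi, D chi -> ~~ free y chi) -> ~~ free y psi ->
    fnd (relativized D (y :: Y)) (star psi) ->
    fnd (relativized D [seq x <- Y | x != y]) (star psi).
  move=> nG ny H; apply: (@fnd_drop _ y); rewrite ?free_star //.
    by apply: relativized_notfree; rewrite // mem_filter eqxx.
  apply: nd_weak (@relativized_cons _ _ _) _.
  apply: nd_weak (relativized_sub _ _) H => //.
  by move=> x; rewrite !inE mem_filter; case: (x == y).
have sortR t i D Y : has_sort t i -> {subset tvars t <= Y} ->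
    fnd (relativized D Y) (fQ i t).
  move=> ti tY; apply: nd_weak (fnd_sort ti tY) => psi [Jp|]; last by right.
  by left; right; left.
elim=> {G phi}.
- move=> G phi _ Gp; exists [::] => Y _.
  case: (pselect (@msl_eq_axioms L phi)) => [/fnd_eq_axioms|np].
    by apply: nd_weak => psi; left; right; right.
  by apply: nd_ass => //; left; left; exists phi.
- move=> G D phi sD _ [X IH]; exists X => Y /IH; apply: nd_weak.
  exact: relativized_sub.
- move=> G phi psi _ _ [X1 IH1] _ [X2 IH2]; exists (X1 ++ X2) => Y /subU[s1 s2].
  by apply: nd_andI => //; [apply: IH1|apply: IH2].
- by move=> G phi psi _ _ [X IH]; exists X => Y /IH; apply: nd_andEl.
- by move=> G phi psi _ _ [X IH]; exists X => Y /IH; apply: nd_andEr.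
- by move=> G phi psi _ _ [X IH]; exists X => Y /IH; apply: nd_orIl.
- by move=> G phi psi _ _ [X IH]; exists X => Y /IH; apply: nd_orIr.
- move=> G phi psi chi _ _ [X IH] _ [X1 IH1] _ [X2 IH2].
  exists (X ++ (X1 ++ X2)) => Y /subU[/IH h /subU[/IH1/rel1 h1 /IH2/rel1]].
  exact: nd_orE h h1.
- by move=> G phi psi _ _ [X IH]; exists X => Y /IH/rel1; apply: nd_impI.
- move=> G phi psi _ _ [X1 IH1] _ [X2 IH2]; exists (X1 ++ X2).
  by move=> Y /subU[/IH1 h /IH2]; apply: nd_impE h.
- by move=> G phi _ _ [X IH]; exists X => Y /IH; apply: nd_botE.
- by move=> G phi _ _ [X IH]; exists X => Y /IH/rel1; apply: nd_raa.
- move=> G x y phi _ /has_sort_tVar yx ff nG ny _ [X IH]; exists X => Y sY.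
  (* The eigenvariable condition forbids a sorting assumption on [y]; it is removed here and
     supplied again by the guard of the relativized quantifier. *)
  apply: (@nd_weak _ _ _ _ _ (relativized G [seq z <- Y | z != y])).
    by apply: relativized_sub => // z; rewrite mem_filter => /andP[].
  apply: (@nd_allI (star_sig L) V _ _ _ x y) => //.
  + by rewrite /= free_for_star.
  + by apply: relativized_notfree; rewrite // mem_filter eqxx.
  + by rewrite -[fAll _ _]/(star (fAll x phi)) free_star.
  rewrite subst_fImp_fQ -yx; apply: nd_impI => //.
  apply: nd_weak (@relativized_cons _ _ _) (IH _ _).
  move=> z /sY zY; rewrite inE mem_filter zY; by case: (z == y).
- move=> G x t phi _ tx ff _ [X IH]; exists (X ++ tvars t) => Y /subU[/IH h sY].
  apply: nd_impE (sortR _ _ _ _ tx sY) => //.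
  rewrite -subst_fImp_fQ; apply: nd_allE h => //.
  by rewrite /= free_for_star.
- move=> G x t phi _ tx ff _ [X IH]; exists (X ++ tvars t) => Y /subU[/IH h sY].
  apply: (@nd_exI (star_sig L) V _ _ _ x t) => //.
    by rewrite /= free_for_star.
  by rewrite subst_fAnd_fQ; apply: nd_andI => //; apply: sortR.
- move=> G x y phi chi _ /has_sort_tVar yx ff nG ny nc _ [X1 IH1] _ [X2 IH2].
  exists (X1 ++ X2) => Y /subU[s1 s2].
  apply: (@nd_weak _ _ _ _ _ (relativized G [seq z <- Y | z != y])).
    by apply: relativized_sub => // z; rewrite mem_filter => /andP[].
  apply: (@nd_exE (star_sig L) V _ _ _ x y (fAnd (fQ x.1 (tVar x)) (star phi))) => //.
  + by rewrite /= free_for_star.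
  + by apply: relativized_notfree; rewrite // mem_filter eqxx.
  + by rewrite -[fEx _ _]/(star (fEx x phi)) free_star.
  + by rewrite free_star.
  (* The major premise may have used the sort of [y], but [y] is not free in its conclusion, so that
     assumption is discharged through [J]. *)
  + apply: (drop _ _ _ (fEx x phi)) => //; apply: IH1 => z /s1.
    by rewrite inE orbC => ->.
  rewrite subst_fAnd_fQ -yx.
  set A := fAnd _ _; set R := relativized _ _.
  have AA : fnd (A |` R) A by apply: nd_ass => //; left.
  (* The assumption [A] is replaced by its two conjuncts, the sort of [y] and the translated
     instance, as the induction hypothesis expects them. *)
  apply: nd_impE (nd_andEl _ AA) => //; apply: nd_impE (nd_andEr _ AA) => //.
  apply: nd_weak (_ : R `<=` _) _; first by move=> psi; right.
  apply: nd_impI => //; apply: nd_impI => //.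
  have: fnd (relativized (subst (tVar y) x phi |` G)
      (y :: [seq z <- Y | z != y])) (star chi).
    by apply: IH2 => z /s2 zY; rewrite inE mem_filter zY; case: (z == y).
  move=> /(nd_weak (@relativized_cons _ _ _)); apply: nd_weak.
  move=> psi [->|/relativizedU1[->|Rp]]; first by left.
    by right; left.
  by right; right.
Qed.

End Relativization.

(** All assumptions of the relativized derivation other than the sorting ones are sentences, as is
    its conclusion, so the sorting assumptions can be discharged one by one. *)
Lemma msl_to_fol (L : msig) (Gamma : set (formula L (mvar L)))
    (phi : formula L (mvar L)) :
  (forall psi, (Gamma `|` [set phi]) psi -> sentence psi) ->
  msl_provable Gamma phi ->
  fol_provable ([set star gamma | gamma in Gamma] `|` @J L) (star phi).
Proof.
move=> hs /fnd_relativized[X /(_ X (fun _ xX => xX)) H].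
apply: (@fnd_drop_sorting _ _ X).
- by move=> psi Jp; left; right.
- move=> psi [[[gamma Gg <-]|/J_sentence //]|[? _ /closures_sentence //]] x.
  by rewrite free_star; apply: hs; left.
- by move=> x; rewrite free_star; apply: hs; right.
apply: nd_weak H => psi [[[gamma [[Gg|//] _] <-]|[Jp|Ep]]|Xp].
- by left; left; left; exists gamma.
- by left; left; right.
- by left; right.
- by right.
Qed.

Theorem theorem3p2 (L : msig)
    (strictR : forall R : relsym L, strict_rel R)
    (strictF : forall f : funsym L, strict_fun f)
    (Gamma : set (formula L (mvar L))) (phi : formula L (mvar L))
    (hsent : forall psi, (Gamma `|` [set phi]) psi ->
       [/\ well_sorted psi, sentence psi & eq_free psi]) :
  msl_provable Gamma phi <->
  fol_provable ([set star gamma | gamma in Gamma] `|` @J L) (star phi).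
Proof.
split; last exact: fol_to_msl.
by apply: msl_to_fol => psi /hsent[].
Qed.
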